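(* There exist a metric space $(V,c)$ (one for each sufficiently large $n=|V|$, with a root $r\in V$) and a constant $\varepsilon_0>0$ such that for any probability distribution $\mathcal{D}$ on tours $\sigma$ of $V$, there exists a set $X\subseteq V$ of size $\Theta(\log n)$ with $$\Pr_{\sigma\leftarrow\mathcal{D}}\left[c(\sigma_X) = o(\log n)\cdot\mathrm{opt}_{TSP}(X)\right] \le \frac{1}{2}\exp(-\varepsilon_0|X|).$$
   Context: A tour $\sigma$ of $V$ is an ordering of the vertices of $V$. For $X\subseteq V$, $\sigma_X$ is the order in which $\sigma$ visits the vertices of $X$, and $c(\sigma_X) := c(r,\sigma_X(1)) + \sum_{i=1}^{|X|-1} c(\sigma_X(i),\sigma_X(i+1)) + c(\sigma_X(|X|),r)$. $\mathrm{opt}_{TSP}(X)$ is the minimum cost of a tour visiting $X\cup\{r\}$. Asymptotics are as $n\to\infty$. *)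

(* Defs.v *)
From HB Require Import structures.
From mathcomp Require Import all_boot all_order all_fingroup all_algebra.
From mathcomp Require Import reals sequences exp.
Set Implicit Arguments. Unset Strict Implicit. Unset Printing Implicit Defensive.
Import Order.TTheory GRing.Theory Num.Theory.
Local Open Scope ring_scope.

Section TSP.
Variable R : realType.

Definition is_metric (T : finType) (c : T -> T -> R) : Prop :=
  [/\ (forall x y, 0 <= c x y),
      (forall x y, c x y = 0 <-> x = y),
      (forall x y, c x y = c y x) &
      (forall x y z, c x z <= c x y + c y z)].

Fixpoint walk_cost (T : Type) (c : T -> T -> R) (x : T) (s : seq T) : R :=
  match s with
  | [::] => 0
  | y :: s' => c x y + walk_cost c y s'
  end.

Definition tour_cost (T : Type) (c : T -> T -> R) (r : T) (s : seq T) : R :=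
  walk_cost c r (rcons s r).

(* a tour sigma of V = 'I_m is the ordering sigma 0, sigma 1, ..., sigma (m-1);
   sigma_X is the order in which sigma visits the vertices of X *)
Definition visit_order (m : nat) (sigma : {perm 'I_m}) (X : {set 'I_m}) : seq 'I_m :=
  filter (fun v => v \in X) (map sigma (enum 'I_m)).

Definition opt_TSP (T : finType) (c : T -> T -> R) (r : T) (X : {set T}) : R :=
  let L := [seq tour_cost c r s | s <- permutations (enum (X :\ r))] in
  foldr Num.min (head 0 L) L.

Definition is_distribution (m : nat) (D : {ffun {perm 'I_m} -> R}) : Prop :=
  (forall s, 0 <= D s) /\ \sum_(s : {perm 'I_m}) D s = 1.

Definition Prob (m : nat) (D : {ffun {perm 'I_m} -> R}) (P : {perm 'I_m} -> bool) : R :=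
  \sum_(s : {perm 'I_m} | P s) D s.

Definition little_o_log (g : nat -> R) : Prop :=
  forall e : R, 0 < e -> exists M : nat, forall n : nat, (M <= n)%N ->
    `|g n| <= e * ln (n%:R).

End TSP.

(* Main.v *)
(* Idea. The points of V carry, up to an additive 1, the metric of a Cayley graph of F_2^m
   with 2^m <= |V| < 2^(m+1), whose 8m generators (besides the unit vectors) come from a
   linear code of relative distance at least 1/8: the nontrivial eigenvalues of the lazy
   walk are at most 7/8, while a ball of radius m/20 has at most (3/2)^m points.  By
   averaging it is enough to find a random X that defeats every fixed tour, and X is the
   union of the traces P and Q of two independent lazy walks with 256m steps and uniform
   starting points.

   Cut the tour into m blocks of equal length.  A walk confined to a set of density 7/8
   loses a constant factor of L2 mass at each step, so a union bound over the 2^m sets of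
   blocks shows that P misses more than a quarter of the blocks with probability at most
   2^-m only; likewise Q.  All points of P are at distance at least m/20 from all points of
   Q, except with probability exponentially small in m, because the balls are small.
   Otherwise at least m/2 blocks contain points of both P and Q, and the tour pays m/20 in
   each of them, m^2/40 in total, whereas following P and then Q costs only O(m). *)

Require Import Defs.
From HB Require Import structures.
From mathcomp Require Import all_boot all_order all_fingroup all_algebra.
From mathcomp Require Import reals sequences exp boolp.
From mathcomp Require Import ring lra zify.
Set Implicit Arguments. Unset Strict Implicit. Unset Printing Implicit Defensive.
Import Order.TTheory GRing.Theory Num.Theory.
Local Open Scope ring_scope.

(** * Fourier analysis on F_2^m and the L2 contraction of a walk step *)

Local Notation cube m := {ffun 'I_m -> bool}.

(** Cauchy-Schwarz on the support [U], by Lagrange's identity: the squared differences over pairs in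
    [U] sum to twice the deficit. *)
Lemma sqr_sum_le (R : realType) (T : finType) (U : {set T}) (f : T -> R) :
  (forall x, x \notin U -> f x = 0) ->
  (\sum_x f x) ^+ 2 <= #|U|%:R * \sum_x f x ^+ 2.
Proof.
move=> fU.
have e1 : \sum_x f x = \sum_(x in U) f x.
  by rewrite [RHS]big_mkcond; apply: eq_bigr => x _; case: ifPn => // /fU.
have e2 : \sum_x f x ^+ 2 = \sum_(x in U) f x ^+ 2.
  rewrite [RHS]big_mkcond; apply: eq_bigr => x _; case: ifPn => // /fU ->.
  by rewrite expr0n.
rewrite e1 e2; set s := \sum_(x in U) f x; set t := \sum_(x in U) _.
have : 0 <= \sum_(x in U) \sum_(y in U) (f x - f y) ^+ 2.
  by apply: sumr_ge0 => x _; apply: sumr_ge0 => y _; exact: sqr_ge0.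
suff -> : \sum_(x in U) \sum_(y in U) (f x - f y) ^+ 2 = 2 * (#|U|%:R * t - s ^+ 2).
  by rewrite pmulr_rge0 // subr_ge0.
have h x : \sum_(y in U) (f x - f y) ^+ 2 = #|U|%:R * f x ^+ 2 + t + (- 2 * s) * f x.
  rewrite /t /s mulr_sumr mulr_suml mulr_natl -sumr_const -!big_split /=.
  by apply: eq_bigr => y _; ring.
under eq_bigr => x _ do rewrite h.
rewrite !big_split /= -!mulr_sumr -/s -/t sumr_const -[t *+ _]mulr_natl; ring.
Qed.

Section Fourier.
Variables (R : realType) (m : nat).
Implicit Types (u x y : cube m) (f : cube m -> R).

Lemma sum_cube_prod n (F : 'I_n -> bool -> R) :
  \sum_(u : cube n) \prod_i F i (u i) = \prod_i (F i true + F i false).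
Proof.
rewrite -(bigA_distr_bigA F).
by apply: eq_bigr => i _; rewrite big_bool.
Qed.

Lemma card_cube : #|{: cube m}| = (2 ^ m)%N.
Proof. by rewrite card_ffun card_bool card_ord. Qed.

Lemma cube_addE x y i : (x + y) i = x i (+) y i.
Proof. by rewrite ffunE. Qed.

Lemma cube_addxx x : x + x = 0.
Proof. by apply/ffunP => i; rewrite cube_addE addbb ffunE. Qed.

Lemma cube_addKr x : involutive (fun y => y + x).
Proof. by move=> y; rewrite -addrA cube_addxx addr0. Qed.

Lemma cube_add_eq0 x y : (x + y == 0) = (x == y).
Proof.
apply/eqP/eqP => [h|->]; last exact: cube_addxx.
by rewrite -[x](cube_addKr y) h add0r.
Qed.

(** The characters of F_2^m, with values 1 and -1 in [R]. *)
Definition chi u x : R := \prod_i (-1) ^+ (u i && x i).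

Lemma chiC u x : chi u x = chi x u.
Proof. by apply: eq_bigr => i _; rewrite andbC. Qed.

Lemma chiD u x y : chi u (x + y) = chi u x * chi u y.
Proof.
rewrite -big_split /=; apply: eq_bigr => i _; rewrite cube_addE.
by case: (u i) (x i) (y i) => [] [] [] /=; rewrite ?expr0 ?expr1 ?mulr1 ?mul1r ?mulrNN ?mulr1.
Qed.

Lemma chi0 x : chi 0 x = 1.
Proof. by rewrite /chi big1 // => i _; rewrite ffunE. Qed.

Lemma chi_sign u x : chi u x = 1 \/ chi u x = -1.
Proof.
rewrite /chi; elim/big_ind: _ => [|a b [->|->] [->|->]|i _];
  try by [left|right|left; ring|right; ring].
by case: (_ && _); [right; rewrite expr1|left].
Qed.

Lemma sum_chi x : \sum_u chi u x = if x == 0 then 2 ^+ m else 0.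
Proof.
rewrite (sum_cube_prod (fun i b => (-1) ^+ (b && x i))).
case: eqP => [->|/eqP xn0].
  under eq_bigr => i _ do rewrite !ffunE /= expr0.
  by rewrite prodr_const card_ord.
have [i xi] : exists i, x i.
  apply/existsP; apply: contraR xn0 => /existsPn h; apply/eqP/ffunP => i.
  by rewrite ffunE; apply/negbTE/h.
by rewrite (bigD1 i) //= xi /= expr1 expr0 addNr mul0r.
Qed.

(** Unnormalised Fourier coefficient, whence the factor [2 ^+ m] in Parseval's identity. *)
Definition fhat f u : R := \sum_x chi u x * f x.

Lemma parseval f : \sum_u fhat f u ^+ 2 = 2 ^+ m * \sum_x f x ^+ 2.
Proof.
transitivity (\sum_x \sum_y f x * f y * \sum_u chi u (x + y)).
  under eq_bigr => u _.
    rewrite expr2 /fhat mulr_suml.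
    under eq_bigr => x _.
      rewrite mulr_sumr.
      over.
    over.
  rewrite exchange_big /=; apply: eq_bigr => x _.
  rewrite exchange_big /=; apply: eq_bigr => y _.
  rewrite mulr_sumr; apply: eq_bigr => u _; rewrite chiD; ring.
rewrite mulr_sumr; apply: eq_bigr => x _.
rewrite (bigD1 x) //= sum_chi cube_add_eq0 eqxx big1 ?addr0; first by ring.
by move=> y yx; rewrite sum_chi cube_add_eq0 eq_sym (negbTE yx) mulr0.
Qed.

Variables (S : finType) (st : S -> cube m).

Definition step_sum f x : R := \sum_s f (x + st s).

(** The characters diagonalise every Cayley graph: a shift by [st s] multiplies the coefficient at
    [u] by [chi u (st s)]. *)
Lemma fhat_step_sum f u : fhat (step_sum f) u = fhat f u * \sum_s chi u (st s).
Proof.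
rewrite /fhat /step_sum mulr_sumr.
under eq_bigr => x _ do rewrite mulr_sumr.
rewrite exchange_big /=; apply: eq_bigr => s _.
rewrite (reindex_inj (inv_inj (cube_addKr (st s)))) mulr_suml.
by apply: eq_bigr => x _; rewrite cube_addKr chiD; ring.
Qed.

Lemma sum_step_sum f : \sum_x step_sum f x = #|S|%:R * \sum_x f x.
Proof.
rewrite /step_sum exchange_big /= mulr_natl -sumr_const.
by apply: eq_bigr => s _; rewrite [RHS](reindex_inj (inv_inj (cube_addKr (st s)))).
Qed.

(* The constants only have to satisfy 15/64 * 7/8 + (7/8)^2 <= 63/64. *)
Lemma step_sum_contract (U : {set cube m}) f :
  (forall u, u != 0 -> `|\sum_s chi u (st s)| <= 7 / 8 * #|S|%:R) ->
  #|U|%:R <= 7 / 8 * 2 ^+ m :> R ->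
  (forall x, x \notin U -> f x = 0) ->
  \sum_x step_sum f x ^+ 2 <= 63 / 64 * #|S|%:R ^+ 2 * \sum_x f x ^+ 2.
Proof.
move=> gap Usmall fU; set D : R := #|S|%:R; set F := \sum_x f x ^+ 2.
have F0 : 0 <= F by apply: sumr_ge0 => x _; exact: sqr_ge0.
have p0 : 0 < 2 ^+ m :> R by rewrite exprn_gt0.
rewrite -(ler_pM2l p0) -parseval.
(* The trivial coefficient is the one that the gap does not shrink; the small support keeps it at
   7/8 of the total mass or less. *)
have h0 : fhat f 0 ^+ 2 <= 7 / 8 * 2 ^+ m * F.
  have -> : fhat f 0 = \sum_x f x by apply: eq_bigr => x _; rewrite chi0 mul1r.
  by apply: (le_trans (sqr_sum_le fU)); rewrite ler_wpM2r.
have hs : \sum_(u : cube m | u != 0) fhat f u ^+ 2 = 2 ^+ m * F - fhat f 0 ^+ 2.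
  by rewrite -parseval [in RHS](bigD1 (0 : cube m)) //= [RHS]addrC addKr.
rewrite (bigD1 (0 : cube m)) //= fhat_step_sum.
have -> : \sum_s chi 0 (st s) = D.
  by under eq_bigr => s _ do rewrite chi0; rewrite sumr_const.
have h1 : \sum_(u : cube m | u != 0) fhat (step_sum f) u ^+ 2 <=
    49 / 64 * D ^+ 2 * (2 ^+ m * F - fhat f 0 ^+ 2).
  rewrite -hs mulr_sumr; apply: ler_sum => u /gap; rewrite -/D => hu.
  rewrite fhat_step_sum exprMn mulrC ler_wpM2r ?sqr_ge0 //.
  rewrite -[X in X <= _]real_normK ?num_real //.
  have -> : 49 / 64 * D ^+ 2 = (7 / 8 * D) ^+ 2 by field.
  rewrite lerXn2r ?nnegrE ?normr_ge0 //.
  by have D0 : 0 <= D; [rewrite ler0n|lra].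
apply: le_trans (_ : (fhat f 0 * D) ^+ 2 + 49 / 64 * D ^+ 2 * (2 ^+ m * F - fhat f 0 ^+ 2) <= _);
  first by rewrite lerD2l.
have -> : (fhat f 0 * D) ^+ 2 + 49 / 64 * D ^+ 2 * (2 ^+ m * F - fhat f 0 ^+ 2) =
    D ^+ 2 * (15 / 64 * fhat f 0 ^+ 2 + 49 / 64 * (2 ^+ m * F)) by field.
have -> : 2 ^+ m * (63 / 64 * D ^+ 2 * F) = D ^+ 2 * (63 / 64 * (2 ^+ m * F)) by ring.
apply: ler_wpM2l; first exact: sqr_ge0.
have : 0 <= 2 ^+ m * F by rewrite mulr_ge0 // ltW.
move: h0; rewrite -mulrA; lra.
Qed.

End Fourier.

Lemma sum_nat_pred (T : finType) (P : pred T) :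
  (\sum_x P x = #|[set x | P x]|)%N.
Proof. by rewrite -sum1dep_card [RHS]big_mkcond; apply: eq_bigr => x _; case: (P x). Qed.

(** * A linear code of relative distance 1/8 and its spectral gap *)

Section Code.
Variables (R : realType) (m : nat).

(* First moment: a uniformly random [h] has expected value
   [2 ^ m * (5 / 8) ^ (8 * m) < 4 ^- m] for the sum over [u] of the products below,
   and each product is [4 ^- w], where [w] is the weight of the codeword of [u]. *)
Lemma exists_code : (0 < m)%N -> exists h : {ffun 'I_(8 * m) -> cube m},
  forall u, u != 0 -> (m <= #|[set j | (chi R u (h j) == -1)%R]|)%N.
Proof.
move=> m0; set N := (8 * m)%N.
(* The affine function of the character that is 1 at character value 1 and 1/4 at -1; its mean is
   5/8 for [u != 0]. *)
pose w (u x : cube m) : R := (5 + 3 * chi R u x) / 8.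
have w_ge0 u x : 0 <= w u x.
  by rewrite /w; case: (chi_sign R u x) => ->; lra.
have sumw (u : cube m) : u != 0 -> \sum_x w u x = 2 ^+ m * (5 / 8).
  move=> un0; rewrite /w -mulr_suml big_split /= -mulr_sumr.
  under [X in _ + 3 * X]eq_bigr => x _ do rewrite chiC.
  rewrite sum_chi (negbTE un0) sumr_const cardT -cardE card_cube.
  by rewrite -[_ *+ _]mulr_natr natrX; field.
have total : \sum_(h : {ffun 'I_N -> cube m}) \sum_(u : cube m | u != 0) \prod_j w u (h j)
    = \sum_(u : cube m | u != 0) (2 ^+ m * (5 / 8)) ^+ N.
  rewrite exchange_big /=; apply: eq_bigr => u un0.
  rewrite -(bigA_distr_bigA (fun _ : 'I_N => w u)) /=.
  by rewrite sumw // prodr_const card_ord.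
have [h hsmall] : exists h : {ffun 'I_N -> cube m},
    \sum_(u : cube m | u != 0) \prod_j w u (h j) < 4^-1 ^+ m.
  apply: contrapT => /forallNP no.
  have : \sum_(h : {ffun 'I_N -> cube m}) 4^-1 ^+ m <=
      \sum_(h : {ffun 'I_N -> cube m}) \sum_(u : cube m | u != 0) \prod_j w u (h j).
    by apply: ler_sum => h _; rewrite leNgt; apply/negP/no.
  have cst : \sum_(h : {ffun 'I_N -> cube m}) 4^-1 ^+ m = (2 ^+ m) ^+ N * 4^-1 ^+ m :> R.
    by rewrite sumr_const card_ffun card_cube card_ord -[LHS]mulr_natl !natrX.
  rewrite leNgt => /negP; apply; rewrite total cst.
  have le1 : \sum_(u : cube m | u != 0) (2 ^+ m * (5 / 8 : R)) ^+ N <=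
      2 ^+ m * (2 ^+ m * (5 / 8)) ^+ N.
    rewrite sumr_const -[_ *+ _]mulr_natl; apply: ler_wpM2r.
      by apply: exprn_ge0; apply: mulr_ge0; [exact: exprn_ge0|lra].
    by rewrite -natrX ler_nat -card_cube max_card.
  apply: (le_lt_trans le1); rewrite exprMn mulrCA ltr_pM2l ?exprn_gt0 //.
  (* What remains is the [m]-th power of [2 * (5 / 8) ^ 8 < 1 / 4]. *)
  rewrite /N exprM -exprMn ltrXn2r -?lt0n //; lra.
(* A codeword of weight below [m] would alone contribute at least [4 ^- m] to the sum. *)
exists h => u un0; rewrite leqNgt; apply/negP => few.
have : 4^-1 ^+ m <= \prod_j w u (h j).
  rewrite (bigID (fun j => chi R u (h j) == -1)) /= [X in _ * X]big1 ?mulr1; last first.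
    by move=> j; rewrite /w; case: (chi_sign R u (h j)) => ->; rewrite ?eqxx // => _; lra.
  rewrite (eq_bigr (fun => 4^-1)); last by move=> j /eqP; rewrite /w => ->; lra.
  by rewrite prodr_const -cardsE; apply: ler_wiXn2l (ltnW few); lra.
rewrite leNgt => /negP; apply; apply: le_lt_trans hsmall.
rewrite (bigD1 u) //= lerDl; apply: sumr_ge0 => v _.
by apply: prodr_ge0 => j _; exact: w_ge0.
Qed.

(** The walk moves along the [h j] only. The Boolean makes it lazy, which rules out negative
    eigenvalues. *)
Definition code_step (h : 'I_(8 * m) -> cube m) (s : 'I_(8 * m) * bool) : cube m :=
  if s.2 then h s.1 else 0.

(** Each [j] contributes 2 if the character is 1 at [h j] and otherwise 0, since the lazy choice
    cancels the move. At most [7 * m] of the [8 * m] indices contribute. *)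
Lemma code_step_gap (h : 'I_(8 * m) -> cube m) (u : cube m) :
  (m <= #|[set j | (chi R u (h j) == -1)%R]|)%N ->
  `|\sum_s chi R u (code_step h s)| <= 7 / 8 * #|{: 'I_(8 * m) * bool}|%:R.
Proof.
move=> big_wt; rewrite -(pair_bigA _ (fun j b => chi R u (code_step h (j, b)))) /=.
have chi_1 j : \sum_(b : bool) chi R u (code_step h (j, b)) =
    2 * (chi R u (h j) != -1)%:R.
  rewrite big_bool /code_step /= [chi R u 0]chiC chi0.
  case: (chi_sign R u (h j)) => ->; last by rewrite eqxx /=; ring.
  by have -> : (1 != -1 :> R); [apply/eqP; lra|rewrite /=; ring].
under eq_bigr => j _ do rewrite chi_1.
rewrite -mulr_sumr -natr_sum sum_nat_pred.
set pos := #|_|; set neg := #|_| in big_wt.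
have -> : #|{: 'I_(8 * m) * bool}| = (8 * m * 2)%N.
  by rewrite card_prod card_ord card_bool.
have cnt : (neg + pos = 8 * m)%N.
  by rewrite -[in RHS](card_ord (8 * m)) -[RHS](cardsC [set j | (chi R u (h j) == -1)%R])
    /neg /pos; congr (_ + _)%N; apply: eq_card => j; rewrite !inE.
have cntR : neg%:R + pos%:R = 8 * m%:R :> R by rewrite -natrD cnt natrM.
have mR : m%:R <= neg%:R :> R by rewrite ler_nat.
have pos0 : 0 <= pos%:R :> R by [].
rewrite ger0_norm ?mulr_ge0 // !natrM; lra.
Qed.

End Code.

(** * Counting walks with a uniform starting point *)

Section Walks.
Variables (R : realType) (m : nat) (S : finType) (st : S -> cube m).

(** Traces are listed with multiplicity, one per sequence of steps, so that sums over the list are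
    unnormalised expectations. A walk of [k] steps has [k + 1] points. *)
Fixpoint walks k (x : cube m) : seq (seq (cube m)) :=
  if k is k'.+1 then [seq x :: p | s <- enum S, p <- walks k' (x + st s)]
  else [:: [:: x]].

Definition all_walks k := [seq p | x <- enum {: cube m}, p <- walks k x].

Lemma walksP k x p : p \in walks k x ->
  exists2 t, p = x :: t & size t = k /\ path (fun x y => [exists s, y == x + st s]) x t.
Proof.
elim: k x p => [|k IH] x p /=; first by rewrite inE => /eqP ->; exists [::].
case/allpairsPdep => s [q [_ /IH [t -> [st_ pt]] ->]].
exists ((x + st s) :: t) => //=; rewrite st_ pt andbT; split=> //.
by apply/existsP; exists s.
Qed.

Lemma sum_walksS k x (F : seq (cube m) -> R) :
  \sum_(p <- walks k.+1 x) F p = \sum_s \sum_(p <- walks k (x + st s)) F (x :: p).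
Proof. by rewrite /= big_allpairs_dep big_enum. Qed.

Lemma sum_all_walks k (F : seq (cube m) -> R) :
  \sum_(p <- all_walks k) F p = \sum_x \sum_(p <- walks k x) F p.
Proof. by rewrite big_allpairs_dep big_enum. Qed.

Lemma walks_count k x : \sum_(p <- walks k x) 1 = #|S|%:R ^+ k :> R.
Proof.
elim: k x => [|k IH] x; first by rewrite big_seq1.
rewrite sum_walksS (eq_bigr (fun=> #|S|%:R ^+ k)) => [|s _]; last exact: IH.
by rewrite sumr_const exprS mulr_natl.
Qed.

Lemma all_walks_count k : \sum_(p <- all_walks k) 1 = 2 ^+ m * #|S|%:R ^+ k :> R.
Proof.
rewrite sum_all_walks; under eq_bigr => x _ do rewrite walks_count.
by rewrite sumr_const cardT -cardE card_cube -[LHS]mulr_natl natrX.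
Qed.

(** The uniform distribution is stationary, so each of the [k + 1] positions is uniformly
    distributed. *)
Lemma sum_walks_marginal k (f : cube m -> R) :
  \sum_(p <- all_walks k) \sum_(y <- p) f y = k.+1%:R * #|S|%:R ^+ k * \sum_x f x.
Proof.
rewrite sum_all_walks; elim: k => [|k IH].
  by rewrite mul1r expr0 mul1r; apply: eq_bigr => x _; rewrite !big_seq1.
under eq_bigr => x _ do rewrite sum_walksS.
transitivity (\sum_x (#|S|%:R ^+ k.+1 * f x +
    step_sum st (fun x => \sum_(p <- walks k x) \sum_(y <- p) f y) x)).
  apply: eq_bigr => x _.
  under eq_bigr => s _ do under eq_bigr => p _ do rewrite big_cons -[f x]mul1r.
  under eq_bigr => s _ do rewrite big_split /= -mulr_suml walks_count.
  by rewrite big_split /= sumr_const exprS -[_ *+ #|_|]mulr_natl mulrA.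
rewrite big_split /= -mulr_sumr sum_step_sum IH -[k.+2%:R]natr1 exprS; ring.
Qed.

(** Counting the walks that stay in [U] alternates a step with restriction to [U], so every step
    shrinks the squared L2 norm by 63/64. Cauchy-Schwarz leads back from L2 to the count, hence the
    squared form. *)
Lemma walks_stay (U : {set cube m}) k :
  (forall u, u != 0 -> `|\sum_s chi R u (st s)| <= 7 / 8 * #|S|%:R) ->
  #|U|%:R <= 7 / 8 * 2 ^+ m :> R ->
  (\sum_(p <- all_walks k) (all [in U] p)%:R) ^+ 2 <=
    (2 ^+ m * #|S|%:R ^+ k) ^+ 2 * (63 / 64) ^+ k :> R.
Proof.
move=> gap Usmall.
pose F k x : R := \sum_(p <- walks k x) (all [in U] p)%:R.
have FS n x : F n.+1 x = (x \in U)%:R * step_sum st (F n) x.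
  rewrite /F sum_walksS /step_sum mulr_sumr; apply: eq_bigr => s _.
  by rewrite mulr_sumr; apply: eq_bigr => p _; rewrite /= -natrM mulnb.
have F0 x : F 0%N x = (x \in U)%:R by rewrite /F big_seq1 /= andbT.
have FU n x : x \notin U -> F n x = 0.
  by case: n => [|n] /negbTE xU; rewrite ?F0 ?FS xU ?mul0r.
have sumF n : \sum_x F n x ^+ 2 <= 2 ^+ m * (63 / 64 * #|S|%:R ^+ 2) ^+ n.
  elim: n => [|n IH].
    rewrite expr0 mulr1 (eq_bigr (fun x => (x \in U)%:R)) => [|x _]; last first.
      by rewrite F0; case: (x \in U); rewrite ?expr0n ?expr1n.
    rewrite -natr_sum sum_nat_pred -natrX ler_nat -card_cube; exact: max_card.
  rewrite exprS mulrCA.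
  apply: le_trans (_ : 63 / 64 * #|S|%:R ^+ 2 * \sum_x F n x ^+ 2 <= _); last first.
    apply: ler_wpM2l IH; apply: mulr_ge0; [lra|exact: sqr_ge0].
  apply: le_trans (step_sum_contract gap Usmall (FU n)).
  apply: ler_sum => x _; rewrite FS exprMn.
  by case: (x \in U); rewrite ?expr1n ?mul1r ?expr0n ?mul0r ?sqr_ge0.
rewrite sum_all_walks; apply: le_trans (sqr_sum_le (FU k)) _.
apply: le_trans (_ : 2 ^+ m * \sum_x F k x ^+ 2 <= _).
  apply: ler_wpM2r; first by apply: sumr_ge0 => x _; exact: sqr_ge0.
  by rewrite -natrX ler_nat -card_cube max_card.
apply: le_trans (ler_wpM2l _ (sumF k)) _; first by rewrite exprn_ge0.
rewrite exprMn -exprM mulnC exprM le_eqVlt; apply/orP; left; apply/eqP; ring.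
Qed.

End Walks.

(** * The word metric and the size of its balls *)

Section CodeNorm.
Variables (m N : nat) (h : 'I_N -> cube m).
Implicit Types (x y z : cube m) (b : cube N).

Definition weight {n} (x : cube n) : nat := (\sum_i x i)%N.
Arguments weight {n} x%_ring_scope.

Lemma weight_add n (x y : cube n) : (weight (x + y) <= weight x + weight y)%N.
Proof.
rewrite /weight -big_split /=; apply: leq_sum => i _.
by rewrite cube_addE; case: (x i) (y i) => [] [].
Qed.

Lemma weight_le n (x : cube n) : (weight x <= n)%N.
Proof.
rewrite -[leqRHS]card_ord -sum1_card; apply: leq_sum => i _; exact: leq_b1.
Qed.

Lemma weight0 n : weight (0 : cube n) = 0%N.
Proof. by rewrite /weight big1 // => i _; rewrite ffunE. Qed.

Definition code_sum b : cube m := \sum_j (if b j then h j else 0).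

Lemma code_sumD b b' : code_sum (b + b') = code_sum b + code_sum b'.
Proof.
rewrite -big_split; apply: eq_bigr => j _ /=; rewrite cube_addE.
by case: (b j) (b' j) => [] []; rewrite /= ?addr0 ?add0r ?cube_addxx.
Qed.

(* Word length in [F_2^m] for the generating set made of the unit vectors and the
   [h j]: the unit vectors make up for the difference between [z] and [code_sum b]. *)
Definition code_norm z : nat :=
  let b := [arg min_(b < (0 : cube N)) (weight (z + code_sum b) + weight b)] in
  (weight (z + code_sum b) + weight b)%N.
Arguments code_norm z%_ring_scope.

Lemma code_norm_le z b : (code_norm z <= weight (z + code_sum b) + weight b)%N.
Proof. by rewrite /code_norm; case: arg_minnP => // b' _; apply. Qed.

Lemma code_norm_ex z : exists b, code_norm z = (weight (z + code_sum b) + weight b)%N.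
Proof. by eexists. Qed.

Lemma code_norm_le_dim z : (code_norm z <= m)%N.
Proof.
apply: leq_trans (code_norm_le z 0) _; rewrite weight0 addn0; exact: weight_le.
Qed.

Lemma code_norm0 : code_norm 0 = 0%N.
Proof.
apply/eqP; rewrite -leqn0; apply: leq_trans (code_norm_le 0 0) _.
rewrite add0r weight0 addn0 /code_sum big1 ?weight0 // => j _.
by rewrite ffunE.
Qed.

Lemma code_normD y z : (code_norm (y + z) <= code_norm y + code_norm z)%N.
Proof.
case: (code_norm_ex y) (code_norm_ex z) => b -> [b' ->].
apply: leq_trans (code_norm_le _ (b + b')) _.
rewrite code_sumD addrACA addnACA leq_add ?weight_add //.
Qed.

Lemma code_norm_gen j : (code_norm (h j) <= 1)%N.
Proof.
pose b : cube N := [ffun i => i == j].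
apply: leq_trans (code_norm_le _ b) _.
have -> : code_sum b = h j.
  rewrite /code_sum (bigD1 j) //= ffunE eqxx big1 ?addr0 // => i ij.
  by rewrite ffunE (negbTE ij).
rewrite cube_addxx weight0 add0n /weight (bigD1 j) //= ffunE eqxx big1 // => i ij.
by rewrite ffunE (negbTE ij).
Qed.

(* Exponential Markov inequality with base 100. *)
Lemma code_ball_card (R : realType) r :
  #|[set z | (code_norm z <= r)%N]|%:R <= 100 ^+ r * (101 / 100) ^+ (m + N) :> R.
Proof.
have wsum n : \sum_(x : cube n) (100^-1 : R) ^+ weight x = (101 / 100) ^+ n.
  transitivity (\sum_(x : cube n) \prod_i (100^-1 : R) ^+ x i).
    by apply: eq_bigr => x _; rewrite prodrXr.
  rewrite (sum_cube_prod (fun _ v => (100^-1 : R) ^+ v)) prodr_const card_ord.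
  by congr (_ ^+ _); rewrite expr1 expr0; field.
rewrite -sum_nat_pred natr_sum exprD -!wsum.
(* A pair whose cost is at most [r] has [F z b >= 1], and each point of the ball has such a [b]. *)
pose F z b : R := 100 ^+ r * (100^-1 ^+ weight (z + code_sum b) * 100^-1 ^+ weight b).
apply: (@le_trans _ _ (\sum_z \sum_b F z b)).
  apply: ler_sum => z _.
  have pos b : 0 <= F z b.
    by rewrite /F ?mulr_ge0 ?exprn_ge0 ?invr_ge0.
  case: leqP => [|_]; last by apply: sumr_ge0 => b _.
  case: (code_norm_ex z) => b -> le_r; rewrite (bigD1 b) //= -[1%:R]addr0.
  apply: lerD; last by apply: sumr_ge0 => b' _.
  rewrite /F -exprD exprVn ler_pdivlMr ?exprn_gt0 // mul1r.
  by rewrite ler_eXn2l // ltr1n.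
rewrite exchange_big /F /= le_eqVlt; apply/orP; left; apply/eqP.
rewrite mulrA [RHS]mulr_sumr; apply: eq_bigr => b _.
(* Shifting [z] by [code_sum b] decouples the two weights, and the double sum becomes a product. *)
rewrite [LHS](reindex_inj (inv_inj (cube_addKr (code_sum b)))) /= mulr_sumr mulr_suml.
by apply: eq_bigr => z _; rewrite cube_addKr; ring.
Qed.

Variables (R : realType) (T : finType) (f : T -> cube m).

(* The term [x != y] separates the points that [f] identifies. *)
Definition code_dist (x y : T) : R := (code_norm (f x + f y) + (x != y))%:R.

Lemma code_dist_metric : is_metric code_dist.
Proof.
rewrite /code_dist; split=> [x y|x y|x y|x y z]; first exact: ler0n.
- split=> [/eqP|->]; last by rewrite cube_addxx code_norm0 eqxx.
  by rewrite pnatr_eq0 addn_eq0 eqb0 negbK => /andP[_ /eqP].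
- by rewrite addrC eq_sym.
rewrite -natrD ler_nat addnACA; apply: leq_add.
  apply: leq_trans (code_normD _ _).
  by rewrite addrA cube_addKr.
by case: (x =P y) => [->|_]; [exact: leq_addl|exact: leq_trans (leq_b1 _) (leq_addr _ _)].
Qed.

End CodeNorm.

(** * Tour costs in a metric space: shortcuts and lower bounds *)

Section Tours.
Variables (R : realType) (T : finType) (c : T -> T -> R).
Hypothesis c_metric : is_metric c.
Implicit Types (s : seq T) (X : {set T}).

Lemma dist_ge0 x y : 0 <= c x y. Proof. by case: c_metric => H _ _ _; apply: H. Qed.
Lemma distC x y : c x y = c y x. Proof. by case: c_metric => _ _ H _; apply: H. Qed.
Lemma dist_triangle y x z : c x z <= c x y + c y z.
Proof. by case: c_metric => _ _ _ H; apply: H. Qed.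
Lemma distxx x : c x x = 0. Proof. by case: c_metric => _ H _ _; apply/H. Qed.

Lemma walk_cost_ge0 x s : 0 <= walk_cost c x s.
Proof. by elim: s x => //= y s IH x; rewrite addr_ge0 ?dist_ge0. Qed.

Lemma walk_cost_cat x s s' :
  walk_cost c x (s ++ s') = walk_cost c x s + walk_cost c (last x s) s'.
Proof. by elim: s x => [|y s IH] x /=; rewrite ?add0r // IH addrA. Qed.

Lemma walk_cost_head x y s z : walk_cost c x (rcons s z) <= c x y + walk_cost c y (rcons s z).
Proof.
case: s => [|w s] /=; first by rewrite !addr0 dist_triangle.
by rewrite addrA lerD2r dist_triangle.
Qed.

(** Shortcutting: by the triangle inequality, dropping intermediate stops does not raise the
    cost. *)
Lemma subseq_tour_cost x s s' z : subseq s s' ->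
  walk_cost c x (rcons s z) <= walk_cost c x (rcons s' z).
Proof.
elim: s' s x => [|y s' IH] s x; first by rewrite subseq0 => /eqP ->.
case: s => [|w s] /= sub.
  apply: le_trans (walk_cost_head x y [::] z) _.
  by rewrite lerD2l; apply: IH; exact: sub0seq.
case: (w =P y) sub => [->|_] sub; first by rewrite lerD2l; exact: IH.
apply: le_trans (IH (w :: s) x sub) _; exact: walk_cost_head.
Qed.

Lemma dist_le_walk_cost x y s : y \in s -> c x y <= walk_cost c x s.
Proof.
elim: s x => // w s IH x; rewrite inE /= => /orP[/eqP ->|ys].
  by rewrite lerDl walk_cost_ge0.
by apply: le_trans (dist_triangle w x y) _; rewrite lerD2l IH.
Qed.

Lemma dist_le_walk_cost2 x s y z : y \in x :: s -> z \in x :: s -> c y z <= walk_cost c x s.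
Proof.
elim: s x => [|w s IH] x.
  by rewrite !inE => /eqP -> /eqP ->; rewrite distxx.
rewrite !(in_cons x) => /orP[/eqP ->|ys] /orP[/eqP ->|zs].
- by rewrite distxx walk_cost_ge0.
- exact: dist_le_walk_cost.
- by rewrite distC; exact: dist_le_walk_cost.
by apply: le_trans (IH _ ys zs) _; rewrite /= lerDr dist_ge0.
Qed.

Lemma opt_TSP_le r X s : uniq s -> s =i X :\ r -> opt_TSP c r X <= tour_cost c r s.
Proof.
move=> us sX; rewrite /opt_TSP.
have : tour_cost c r s \in [seq tour_cost c r s | s <- permutations (enum (X :\ r))].
  apply: map_f; rewrite mem_permutations; apply: uniq_perm => //; first exact: enum_uniq.
  by move=> x; rewrite sX mem_enum.
(* Folding [Num.min] stays below every entry of the list whatever the starting value, so [head 0 L]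
   can be generalised. *)
move: (head _ _) => a; elim: [seq _ | _ <- _] => //= b L IH; rewrite inE.
by rewrite ge_min => /orP[/eqP ->|/IH ->]; rewrite ?lexx ?orbT.
Qed.

Lemma opt_TSP_ge0 r X : 0 <= opt_TSP c r X.
Proof.
rewrite /opt_TSP; set L := map _ _.
have : all (fun x => 0 <= x) L.
  by apply/allP => _ /mapP[s _ ->]; exact: walk_cost_ge0.
have : 0 <= head 0 L by rewrite /L; case: permutations => //= s ?; exact: walk_cost_ge0.
move: (head _ _) => a a0; elim: L => //= b L IH /andP[b0 /IH].
by rewrite le_min b0.
Qed.

(** The sequence may repeat vertices and pass through [r]; removing both is a shortcut. *)
Lemma opt_TSP_le_seq r X s : {subset X <= s} -> {subset s <= X} ->
  opt_TSP c r X <= tour_cost c r s.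
Proof.
move=> Xs sX; apply: le_trans (_ : tour_cost c r [seq x <- undup s | x != r] <= _).
  apply: opt_TSP_le; first by rewrite filter_uniq ?undup_uniq.
  move=> x; rewrite mem_filter mem_undup !inE; congr (_ && _).
  by apply/idP/idP; [exact: sX|exact: Xs].
apply: subseq_tour_cost; apply: subseq_trans (filter_subseq _ _) (undup_subseq _).
Qed.

Lemma sorted_filter_ltS (key : T -> nat) k s : sorted (relpre key leq) s ->
  [seq x <- s | (key x < k.+1)%N] =
  [seq x <- s | (key x < k)%N] ++ [seq x <- s | key x == k].
Proof.
elim: s => //= x s IH; rewrite path_sortedE; last by move=> ? ? ?; exact: leq_trans.
case/andP=> /allP xs /IH ->; rewrite ltnS leq_eqVlt.
case: ltngtP => //= kx.
have -> // : [seq y <- s | (key y < k)%N] = [::].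
apply/eqP; rewrite -(negbK (_ == _)) -has_filter; apply/hasPn => y /xs /=.
by rewrite -kx leqNgt.
Qed.

(* Cutting a tour sorted by [key] at the values of [key]: each stretch of constant key
   that meets two points at distance [d] contributes at least [d]. *)
Lemma sorted_walk_cost_ge (key : T -> nat) (d : R) M x s : 0 <= d ->
  sorted (relpre key leq) s -> (forall y, y \in s -> (key y < M)%N) ->
  forall K : {set 'I_M},
    (forall k, k \in K -> exists y z, [/\ y \in s, z \in s, key y = k, key z = k & d <= c y z]) ->
  #|K|%:R * d <= walk_cost c x s.
Proof.
move=> d0 srt keyM K HK.
(* Induction on a threshold [j]: the initial stretch with keys below [j] already pays for the
   members of [K] below [j]. *)
pose cnt j := #|[set k in K | (k < j)%N]|.
suff H j : (j <= M)%N -> (cnt j)%:R * d <= walk_cost c x [seq y <- s | (key y < j)%N].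
  have := H M (leqnn M).
  rewrite (_ : cnt M = #|K|); last by apply: eq_card => k; rewrite !inE ltn_ord andbT.
  by rewrite (_ : [seq y <- s | _] = s) //; apply/all_filterP/allP.
elim: j => [|j IH] jM.
  rewrite (_ : cnt 0%N = 0%N) ?mul0r ?walk_cost_ge0 //.
  by apply/eqP; rewrite cards_eq0; apply/eqP/setP => k; rewrite !inE andbF.
rewrite sorted_filter_ltS // walk_cost_cat.
pose kj := Ordinal jM.
have -> : cnt j.+1 = (cnt j + (kj \in K))%N.
  rewrite addnC /cnt [LHS](cardsD1 kj) !inE ltnS leqnn andbT; congr (_ + _)%N.
  apply: eq_card => k; rewrite !inE ltnS -val_eqE /= andbCA; congr (_ && _).
  by rewrite [RHS]ltn_neqAle.
rewrite natrD mulrDl; apply: lerD; first exact: IH (ltnW jM).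
case: (boolP (kj \in K)) => [kK|_]; last by rewrite mul0r walk_cost_ge0.
rewrite mul1r; case: (HK _ kK) => y [z [ys zs ky kz dyz]]; apply: (le_trans dyz).
have: y \in [seq y <- s | key y == j] by rewrite mem_filter ys ky eqxx.
have: z \in [seq y <- s | key y == j] by rewrite mem_filter zs kz eqxx.
case: [seq _ <- _ | _] => // w t zt yt; apply: le_trans (dist_le_walk_cost2 yt zt) _.
by rewrite /= lerDr dist_ge0.
Qed.

End Tours.

(** * Numerical estimates *)

Section Estimates.
Variable R : realType.
Implicit Types (x : R) (n m : nat).

Lemma bernoulli x n : 0 <= x -> 1 + n%:R * x <= (1 + x) ^+ n.
Proof.
move=> x0; elim: n => [|n IH]; first by rewrite mul0r addr0 expr0.
have n0 : 0 <= n%:R :> R by [].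
rewrite exprS -natr1; apply: le_trans (ler_wpM2l _ IH); last by lra.
by have : 0 <= n%:R * x * x; [rewrite !mulr_ge0|nra].
Qed.

Lemma expr_inv_le (a b : R) n : 0 < a -> 1 <= b * a ^+ n -> a^-1 ^+ n <= b.
Proof. by move=> a0; rewrite exprVn -div1r ler_pdivrMr ?exprn_gt0. Qed.

(** This fixes the walk length [256 * m]: 64 steps give a factor 1/2 by Bernoulli, so 256 steps give
    1/16, the square of 1/4. *)
Lemma gap_power m : (63 / 64 : R) ^+ (256 * m) <= (4^-1 ^+ m) ^+ 2.
Proof.
have half : (63 / 64 : R) ^+ 64 <= 2^-1.
  rewrite (_ : 63 / 64 = (1 + 63^-1)^-1 :> R); last by field.
  apply: expr_inv_le; first by lra.
  have := @bernoulli 63^-1 64; lra.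
rewrite -[leRHS]exprM (mulnC m) (exprM _ 2) (exprM _ 256) (exprM _ 64 4).
apply: lerXn2r; rewrite ?nnegrE ?exprn_ge0 ?divr_ge0 ?invr_ge0 //.
apply: (@le_trans _ _ (2^-1 ^+ 4)); last by lra.
by apply: lerXn2r; rewrite ?nnegrE ?exprn_ge0 ?invr_ge0 ?divr_ge0.
Qed.

(** The radius [m / 20] costs a factor of at most 4/3 per dimension, and the [9 * m] coordinates
    cost [(101 / 100) ^ 9 <= 9 / 8]; the product is 3/2. *)
Lemma ball_power m :
  100 ^+ (m %/ 20) * (101 / 100) ^+ (m + 8 * m) <= (3 / 2) ^+ m :> R.
Proof.
have e1 : 100 <= (4 / 3) ^+ 20 :> R.
  rewrite (_ : 20%N = (5 * 4)%N) // exprM.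
  apply: le_trans (_ : 4 ^+ 4 <= _); first by rewrite -natrX ler_nat.
  by apply: lerXn2r; rewrite ?nnegrE ?exprn_ge0 //; lra.
have e2 : (101 / 100) ^+ 9 <= 9 / 8 :> R by lra.
rewrite -[(m + 8 * m)%N]/(9 * m)%N exprM.
apply: le_trans (_ : (4 / 3) ^+ m * (9 / 8) ^+ m <= _);
  last by rewrite -exprMn lerXn2r ?nnegrE //; lra.
apply: ler_pM; rewrite ?exprn_ge0 //; try lra.
  apply: le_trans (_ : ((4 / 3) ^+ 20) ^+ (m %/ 20) <= _).
    by apply: lerXn2r; rewrite ?nnegrE ?exprn_ge0 //; lra.
  by rewrite -exprM mulnC ler_weXn2l ?leq_trunc_div //; lra.
by apply: lerXn2r; rewrite ?nnegrE ?exprn_ge0 //; lra.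
Qed.

(** The first term pays for two traces that fail to spread, the second for all pairs of positions,
    one on each trace, that might be close. *)
Definition failure_bound m : R :=
  2 * 2^-1 ^+ m + (256 * m).+1%:R ^+ 2 * (3 / 4) ^+ m.

Lemma failure_bound_le m : 10 ^+ 10 <= m%:R :> R ->
  failure_bound m <= 2^-1 * (9 / 10) ^+ m.
Proof.
rewrite /failure_bound => m_big; set M : R := m%:R in m_big *.
have M1 : 1000 * 1000 * 1000 * 10 <= M by lra.
have y1 := @bernoulli (4 / 5) m; have y2 := @bernoulli 20^-1 m; rewrite -/M in y1 y2.
have -> : 2^-1 ^+ m = (9 / 10) ^+ m * (1 + 4 / 5)^-1 ^+ m :> R.
  by rewrite -exprMn; congr (_ ^+ _); field.
have -> : (3 / 4) ^+ m = (9 / 10) ^+ m * (6 / 5)^-1 ^+ m :> R.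
  by rewrite -exprMn; congr (_ ^+ _); field.
rewrite mulrCA [X in _ + X]mulrCA -mulrDr [leRHS]mulrC.
apply: ler_wpM2l; first by apply: exprn_ge0; lra.
have b1 : (1 + 4 / 5)^-1 ^+ m <= 8^-1 :> R by apply: expr_inv_le; lra.
set K : R := (256 * m).+1%:R.
have K0 : 0 < K by rewrite ltr0n.
have KM : K <= 257 * M by rewrite /K -natr1 natrM -/M; lra.
suff b2 : K ^+ 2 * (6 / 5)^-1 ^+ m <= 4^-1 by lra.
rewrite mulrC -ler_pdivlMr ?exprn_gt0 //; apply: expr_inv_le; first by lra.
rewrite mulrAC ler_pdivlMr ?exprn_gt0 // mul1r.
set y : R := (1 + 20^-1) ^+ m in y2.
have yM : M / 20 <= y by lra.
(* Bernoulli gives linear growth only; its cube, available since [(21 / 20) ^ 3 <= 6 / 5], beats the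
   quadratic [K ^+ 2]. *)
have cube_le : y ^+ 3 <= (6 / 5) ^+ m.
  by rewrite -exprM mulnC exprM lerXn2r ?nnegrE ?exprn_ge0 //; lra.
have M3 : (M / 20) ^+ 3 <= y ^+ 3 by rewrite lerXn2r ?nnegrE //; lra.
have K2 : K ^+ 2 <= (257 * M) ^+ 2 by rewrite lerXn2r ?nnegrE //; lra.
have fin : 4 * (257 * M) ^+ 2 <= (M / 20) ^+ 3.
  rewrite (_ : (M / 20) ^+ 3 = M ^+ 2 * (M / 8000)); last by field.
  rewrite (_ : 4 * (257 * M) ^+ 2 = M ^+ 2 * (4 * 257 * 257)); last by ring.
  by apply: ler_wpM2l; [exact: sqr_ge0|lra].
lra.
Qed.

End Estimates.

(** * A random pair of traces defeats every fixed tour *)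

Section Instance.
Variables (R : realType) (m n : nat).
Hypothesis m_gt0 : (0 < m)%N.
Hypothesis m_small : (6 * m <= 2 ^ m)%N.
Variables (e : cube m -> 'I_n.+1) (f : 'I_n.+1 -> cube m).
Hypothesis eK : cancel e f.
Variable h : {ffun 'I_(8 * m) -> cube m}.
Hypothesis h_code :
  forall u, u != 0 -> (m <= #|[set j | (chi R u (h j) == -1)%R]|)%N.

Implicit Types (sigma : {perm 'I_n.+1}) (p q : seq (cube m)).

Let k := (256 * m)%N.
Let c : 'I_n.+1 -> 'I_n.+1 -> R := code_dist h R f.
Let all_p := all_walks (code_step h) k.
Let tot : R := 2 ^+ m * #|{: 'I_(8 * m) * bool}|%:R ^+ k.

Let c_metric : is_metric c := code_dist_metric h R f.

Definition cube_order sigma : seq 'I_n.+1 :=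
  [seq v <- map sigma (enum 'I_n.+1) | v \in codom e].

(** Blocks are cut from the tour restricted to the embedded cube. The successor in the block length
    makes [m] blocks suffice. *)
Definition tour_block sigma (v : 'I_n.+1) : nat :=
  (index v (cube_order sigma) %/ (2 ^ m %/ m).+1)%N.

Lemma mem_tour sigma v : v \in map sigma (enum 'I_n.+1).
Proof. by rewrite -[v](permKV sigma) map_f ?mem_enum. Qed.

Lemma cube_order_uniq sigma : uniq (cube_order sigma).
Proof. by rewrite filter_uniq // map_inj_uniq ?enum_uniq //; exact: perm_inj. Qed.

Lemma mem_cube_order sigma g : e g \in cube_order sigma.
Proof. by rewrite mem_filter codom_f mem_tour. Qed.

Lemma size_cube_order sigma : size (cube_order sigma) = (2 ^ m)%N.
Proof.
rewrite -card_cube -(card_codom (can_inj eK)) -(card_uniqP (cube_order_uniq sigma)).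
by apply: eq_card => v; rewrite mem_filter mem_tour andbT.
Qed.

Lemma tour_block_lt sigma g : (tour_block sigma (e g) < m)%N.
Proof.
rewrite /tour_block ltn_divLR // mulnC.
apply: leq_trans (_ : 2 ^ m <= _)%N.
  by rewrite -(size_cube_order sigma) index_mem mem_cube_order.
by rewrite ltnW // ltn_ceil.
Qed.

Lemma visit_order_sorted sigma (X : {set 'I_n.+1}) : {subset X <= codom e} ->
  sorted (relpre (tour_block sigma) leq) (visit_order sigma X).
Proof.
move=> Xe.
have -> : visit_order sigma X = [seq v <- cube_order sigma | v \in X].
  rewrite -filter_predI; apply: eq_filter => v /=.
  by case: (boolP (v \in X)) => //= /Xe ->.
apply: sorted_filter; first by move=> y x z; exact: leq_trans.
apply/(sortedP (e 0)) => i i_lt; rewrite /= /tour_block.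
by rewrite !index_uniq ?cube_order_uniq ?leq_div2r // ltnW.
Qed.

(** Within a block, the position modulo the block length determines the point. *)
Lemma card_tour_block sigma b :
  (#|[set g | tour_block sigma (e g) == b]| <= (2 ^ m %/ m).+1)%N.
Proof.
set B := (2 ^ m %/ m).+1; rewrite -[leqRHS]card_ord.
pose F g : 'I_B := inord (index (e g) (cube_order sigma) %% B).
rewrite -(card_in_imset (f := F)) ?max_card // => g g'.
rewrite !inE => /eqP gb /eqP g'b /(congr1 val).
rewrite /= !inordK ?ltn_mod // => mod_eq.
have idx : index (e g) (cube_order sigma) = index (e g') (cube_order sigma).
  by rewrite (divn_eq (index (e g) _) B) (divn_eq (index (e g') _) B) mod_eq
    -/(tour_block _ _) gb -/(tour_block _ _) g'b.
apply: (can_inj eK).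
by rewrite -(nth_index (e 0) (mem_cube_order sigma g)) idx nth_index ?mem_cube_order.
Qed.

Definition hit_blocks sigma p : {set 'I_m} :=
  [set b : 'I_m | has (fun g => tour_block sigma (e g) == b) p].

Definition spread sigma p := (3 * m <= 4 * #|hit_blocks sigma p|)%N.

Definition far p q := all (fun x => all (fun y => m %/ 20 < code_norm h (x + y)%R)%N q) p.

Definition bad sigma p q := ~~ [&& spread sigma p, spread sigma q & far p q].

Lemma tot_gt0 : 0 < tot.
Proof. by rewrite mulr_gt0 ?exprn_gt0 // ltr0n card_prod card_ord card_bool !muln_gt0 m_gt0. Qed.

(** A trace that is not spread stays in the union of the blocks it hits. There are at most [2 ^ m]
    choices of blocks, each of probability at most [4 ^- m]. *)
Lemma not_spread_le sigma :
  \sum_(p <- all_p) (~~ spread sigma p)%:R <= tot * 2^-1 ^+ m.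
Proof.
pose U (T : {set 'I_m}) := \bigcup_(b in T) [set g | tour_block sigma (e g) == b].
have U_small (T : {set 'I_m}) : (4 * #|T| < 3 * m)%N -> #|U T|%:R <= 7 / 8 * 2 ^+ m :> R.
  move=> Tsmall.
  have cU : (#|U T| <= #|T| * (2 ^ m %/ m).+1)%N.
    rewrite -sum_nat_const /U; elim/big_ind2: _ => [|a A b B Aa Bb|b _]; first by rewrite cards0.
      exact: leq_trans (leq_card_setU A B).1 (leq_add Aa Bb).
    exact: card_tour_block.
  have qm : (m * (2 ^ m %/ m) <= 2 ^ m)%N by rewrite mulnC leq_trunc_div.
  have : (8 * #|U T| <= 7 * 2 ^ m)%N.
    (* Three quarters of the blocks cover at most [3 / 4 * 2 ^ m + 3 * m / 4] points, and
       [6 * m <= 2 ^ m] bounds the rounding term by [2 ^ m / 8]. *)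
    move: cU qm m_small Tsmall; move: #|U T| #|T| (2 ^ m %/ m)%N (2 ^ m)%N; nia.
  by rewrite -(ler_nat R) !natrM natrX; lra.
have stay (T : {set 'I_m}) : (4 * #|T| < 3 * m)%N ->
    \sum_(p <- all_p) (all [in U T] p)%:R <= tot * 4^-1 ^+ m.
  move=> /U_small UT.
  have := walks_stay k (fun u un0 => code_step_gap (h_code un0)) UT.
  rewrite -/tot -/all_p => sq.
  rewrite -(@ler_pXn2r _ 2) ?nnegrE //; last 2 first.
  - by apply: sumr_ge0.
  - by rewrite mulr_ge0 ?exprn_ge0 ?invr_ge0 // ltW ?tot_gt0.
  apply: (le_trans sq); rewrite [leRHS]exprMn; apply: ler_wpM2l; first exact: sqr_ge0.
  exact: gap_power.
apply: le_trans (_ : \sum_(p <- all_p) \sum_(T : {set 'I_m} | (4 * #|T| < 3 * m)%N)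
    (all [in U T] p)%:R <= _).
  apply: ler_sum => p _; rewrite /spread -ltnNge; case: ltnP => [few|_]; last by apply: sumr_ge0.
  rewrite (bigD1 (hit_blocks sigma p)) //= -[1%:R]addr0; apply: lerD; last by apply: sumr_ge0.
  rewrite (_ : all _ _) //; apply/allP => g gp; apply/bigcupP.
  exists (Ordinal (tour_block_lt sigma g)); rewrite !inE //.
  by apply/hasP; exists g.
rewrite exchange_big /=.
apply: le_trans (_ : \sum_(T : {set 'I_m} | (4 * #|T| < 3 * m)%N) tot * 4^-1 ^+ m <= _).
  by apply: ler_sum => T /stay.
rewrite sumr_const -[_ *+ _]mulr_natl mulrCA; apply: ler_wpM2l; first exact: ltW tot_gt0.
apply: le_trans (_ : 2 ^+ m * 4^-1 ^+ m <= _).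
  apply: ler_wpM2r; first by rewrite exprn_ge0 ?invr_ge0.
  rewrite -natrX ler_nat; apply: leq_trans (max_card _) _.
  by rewrite -cardsT -powersetT card_powerset cardsT card_ord.
by rewrite -exprMn lerXn2r ?nnegrE //; lra.
Qed.

(** Union bound over pairs of positions: for fixed [x] a uniform point falls into the ball around
    [x] with probability at most [(3 / 2) ^ m / 2 ^ m]. *)
Lemma not_far_le :
  \sum_(p <- all_p) \sum_(q <- all_p) (~~ far p q)%:R <=
  tot ^+ 2 * (k.+1%:R ^+ 2 * (3 / 4) ^+ m).
Proof.
set r := (m %/ 20)%N; set D : R := #|{: 'I_(8 * m) * bool}|%:R.
pose near x y := (code_norm h (x + y)%R <= r)%N.
apply: le_trans (_ : \sum_(p <- all_p) \sum_(q <- all_p) \sum_(x <- p) \sum_(y <- q)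
    (near x y)%:R <= _).
  apply: ler_sum => p _; apply: ler_sum => q _.
  have pos x : 0 <= \sum_(y <- q) (near x y)%:R :> R by apply: sumr_ge0.
  case: (boolP (far p q)) => [_|]; first by apply: sumr_ge0.
  case/allPn => x xp /allPn[y yq]; rewrite -leqNgt => nxy.
  rewrite (big_rem x) //= -[1%:R]addr0; apply: lerD; last by apply: sumr_ge0.
  rewrite (big_rem y) //= /near nxy lerDl; exact: sumr_ge0.
have ball x : \sum_y (near x y)%:R <= (3 / 2) ^+ m :> R.
  rewrite (reindex_inj (inv_inj (cube_addKr x))) /=.
  under eq_bigr => y _ do rewrite /near addrC cube_addKr.
  rewrite -natr_sum sum_nat_pred.
  by apply: le_trans (code_ball_card h R r) _; exact: ball_power.
apply: le_trans (_ : \sum_(p <- all_p) \sum_(x <- p) k.+1%:R * D ^+ k * (3 / 2) ^+ m <= _).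
  apply: ler_sum => p _; rewrite exchange_big /=; apply: ler_sum => x _.
  rewrite sum_walks_marginal ler_wpM2l // mulr_ge0 // exprn_ge0 //.
rewrite sum_walks_marginal sumr_const cardT -cardE card_cube -[_ *+ (2 ^ m)%N]mulr_natl natrX -/D.
rewrite (_ : 3 / 4 = 3 / 2 / 2 :> R); last by field.
rewrite [(3 / 2 / 2) ^+ m]expr_div_n /tot -/D.
have p2 : 2 ^+ m != 0 :> R by rewrite expf_neq0 ?pnatr_eq0.
rewrite le_eqVlt; apply/orP; left; apply/eqP.
move: (2 ^+ m) (D ^+ k) ((3 / 2) ^+ m) k.+1%:R p2 => a b b' b'' a0; field.
exact: a0.
Qed.

Lemma bad_le sigma :
  \sum_(p <- all_p) \sum_(q <- all_p) (bad sigma p q)%:R <= tot ^+ 2 * failure_bound R m.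
Proof.
pose ns p : R := (~~ spread sigma p)%:R.
apply: le_trans (_ : \sum_(p <- all_p) \sum_(q <- all_p)
    (ns p + ns q + (~~ far p q)%:R) <= _).
  apply: ler_sum => p _; apply: ler_sum => q _; rewrite /ns /bad.
  by case: (spread _ p) (spread _ q) (far p q) => [] [] [] /=; lra.
have cnt : \sum_(p <- all_p) 1 = tot by exact: all_walks_count.
have -> : \sum_(p <- all_p) \sum_(q <- all_p) (ns p + ns q + (~~ far p q)%:R) =
    2 * tot * (\sum_(p <- all_p) ns p) + \sum_(p <- all_p) \sum_(q <- all_p) (~~ far p q)%:R.
  set s := \sum_(p <- all_p) ns p.
  transitivity (\sum_(p <- all_p) (ns p * tot + s * 1 + \sum_(q <- all_p) (~~ far p q)%:R)).
    apply: eq_bigr => p _; rewrite !big_split /= mulr1 -cnt mulr_sumr; congr (_ + _ + _).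
    by apply: eq_bigr => q _; rewrite mulr1.
  rewrite !big_split /= -mulr_suml -mulr_sumr cnt -/s; ring.
rewrite /failure_bound mulrDr; apply: lerD; last exact: not_far_le.
have := not_spread_le sigma; have := tot_gt0 => t0.
rewrite (_ : tot ^+ 2 * _ = 2 * tot * (tot * 2^-1 ^+ m)); last by ring.
by apply: ler_wpM2l; rewrite mulr_ge0 // ltW.
Qed.

Definition walk_set p q : {set 'I_n.+1} := [set v in map e (p ++ q)].

Lemma walk_size p : p \in all_p -> size p = k.+1.
Proof. by case/allpairsPdep => x [p0 [_ /walksP[t -> [<- _]] ->]]. Qed.

Lemma card_walk_set_le p q : p \in all_p -> q \in all_p -> (#|walk_set p q| <= 514 * m)%N.
Proof.
move=> /walk_size sp /walk_size sq; rewrite cardsE.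
apply: leq_trans (card_size _) _; rewrite size_map size_cat sp sq /k; lia.
Qed.

Lemma card_walk_set_ge sigma p q : spread sigma p -> (3 * m <= 4 * #|walk_set p q|)%N.
Proof.
move=> sp; apply: leq_trans sp _; rewrite leq_pmul2l //.
(* Block numbers are known to be below [m] on the image of [e] only, hence the option type. *)
pose F v : option 'I_m := insub (tour_block sigma v).
rewrite -(card_imset _ Some_inj); apply: leq_trans (leq_imset_card F _).
apply: subset_leq_card; apply/subsetP => v /imsetP[b]; rewrite inE => /hasP[g gp /eqP gb] ->.
apply/imsetP; exists (e g); first by rewrite inE map_f // mem_cat gp.
by rewrite /F gb valK.
Qed.

Lemma spread_tour_cost_ge r sigma p q : spread sigma p -> spread sigma q -> far p q ->
  m%:R ^+ 2 / 40 <= tour_cost c r (visit_order sigma (walk_set p q)).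
Proof.
move=> sp sq pq; set s := visit_order _ _.
have mem_s g : g \in p ++ q -> e g \in s.
  by move=> gpq; rewrite mem_filter mem_tour inE map_f.
have sub : {subset walk_set p q <= codom e}.
  by move=> v; rewrite inE => /mapP[g _ ->]; exact: codom_f.
pose K := hit_blocks sigma p :&: hit_blocks sigma q.
(* Two families of at least 3/4 of the [m] blocks share at least half of them. *)
have K_big : (m <= 2 * #|K|)%N.
  have := cardsUI (hit_blocks sigma p) (hit_blocks sigma q); rewrite -/K.
  have := max_card (hit_blocks sigma p :|: hit_blocks sigma q); rewrite card_ord.
  move: sp sq; rewrite /spread; lia.
have KR : m%:R <= 2 * #|K|%:R :> R by rewrite -natrM ler_nat.
have m0 : 0 <= m%:R :> R by [].
apply: le_trans (_ : #|K|%:R * (m%:R / 20) <= _).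
  by have := ler_wpM2r m0 KR; rewrite expr2; lra.
rewrite /tour_cost -cats1 walk_cost_cat.
apply: le_trans (_ : walk_cost c r s <= _); last by rewrite lerDl walk_cost_ge0.
apply: (sorted_walk_cost_ge (M := m) c_metric _ _ (visit_order_sorted sigma sub)).
- by rewrite divr_ge0.
- move=> v; rewrite mem_filter inE => /andP[/mapP[g _ ->] _]; exact: tour_block_lt.
move=> b; rewrite !inE => /andP[/hasP[x xp /eqP xb] /hasP[y yq /eqP yb]].
exists (e x), (e y); split; rewrite ?mem_s ?mem_cat ?xp ?yq ?orbT //.
have /allP/(_ y yq) := allP pq x xp.
rewrite /c /code_dist !eK; set z := code_norm _ _ => z_big.
have : (m <= 20 * (z + (e x != e y)))%N.
  by have := divn_eq m 20; have := ltn_pmod m (isT : 0 < 20)%N; lia.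
rewrite -(ler_nat R) natrM; lra.
Qed.

Lemma dist_le_dim x y : c x y <= m.+1%:R.
Proof.
by rewrite ler_nat -[m.+1]addn1; apply: leq_add; [exact: code_norm_le_dim|exact: leq_b1].
Qed.

(** A step costs at most 1 for the generator and 1 for the term separating distinct vertices. *)
Lemma walk_cost_le x t :
  path (fun x y => [exists s, y == x + code_step h s]) x t ->
  walk_cost c (e x) (map e t) <= 2 * (size t)%:R.
Proof.
elim: t x => [|y t IH] x /=; first by rewrite mulr0.
case/andP=> /existsP[s /eqP ->] /IH le_t.
rewrite -[(size t).+1%:R]natr1 mulrDr addrC; apply: lerD => //.
rewrite mulr1 ler_nat -[2%N]/(1 + 1)%N; apply: leq_add; last exact: leq_b1.
rewrite !eK addrA cube_addxx add0r /code_step; case: (s.2); first exact: code_norm_gen.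
by rewrite code_norm0.
Qed.

Lemma opt_walk_set_le r p q : p \in all_p -> q \in all_p ->
  opt_TSP c r (walk_set p q) <= 1030 * m%:R.
Proof.
case/allpairsPdep => x [p0 [_ /walksP[t -> [st /walk_cost_le ct]] ->]].
case/allpairsPdep => y [q0 [_ /walksP[t' -> [st' /walk_cost_le ct']] ->]].
apply: le_trans (opt_TSP_le_seq c_metric r (s := map e ((x :: t) ++ (y :: t'))) _ _) _.
- by move=> v; rewrite inE.
- by move=> v vs; rewrite inE.
(* Both traces cost at most [512 * m] each, and the three connecting legs at most [m + 1] each. *)
rewrite /tour_cost map_cat rcons_cat walk_cost_cat /= -cats1 walk_cost_cat /=.
move: ct ct'; rewrite st st' /k !natrM.
have := dist_le_dim r (e x); have := dist_le_dim (last (e x) (map e t)) (e y).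
have := dist_le_dim (last (e y) (map e t')) r.
have : 1 <= m%:R :> R by rewrite ler1n.
rewrite -natr1; lra.
Qed.

Lemma hard_set r (D : {ffun {perm 'I_n.+1} -> R}) (t : R) :
  is_distribution D -> t <= m%:R / (50 * 1000) -> failure_bound R m < 1 ->
  exists X : {set 'I_n.+1}, [/\ (3 * m <= 4 * #|X|)%N, (#|X| <= 514 * m)%N &
    Prob D (fun sigma => tour_cost c r (visit_order sigma X) <= t * opt_TSP c r X)
      <= failure_bound R m].
Proof.
case=> D0 D1 t_small fb1.
pose P p q := Prob D (fun sigma => bad sigma p q).
have avg : \sum_(p <- all_p) \sum_(q <- all_p) P p q <= tot ^+ 2 * failure_bound R m.
  apply: le_trans (_ : \sum_sigma D sigma * (tot ^+ 2 * failure_bound R m) <= _); last first.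
    by rewrite -mulr_suml D1 mul1r.
  apply: le_trans (_ : \sum_sigma D sigma *
      \sum_(p <- all_p) \sum_(q <- all_p) (bad sigma p q)%:R <= _); last first.
    by apply: ler_sum => sigma _; apply: ler_wpM2l => //; exact: bad_le.
  rewrite le_eqVlt; apply/orP; left; apply/eqP.
  under [RHS]eq_bigr => sigma _ do rewrite mulr_sumr.
  rewrite [RHS]exchange_big /=; apply: eq_bigr => p _.
  under [RHS]eq_bigr => sigma _ do rewrite mulr_sumr.
  rewrite [RHS]exchange_big /=; apply: eq_bigr => q _.
  rewrite /P /Prob big_mkcond; apply: eq_bigr => sigma _.
  by case: (bad sigma p q); rewrite ?mulr1 ?mulr0.
(* Averaging: some pair of traces does no worse than the mean. *)
have [p [q [pw qw Ppq]]] : exists p q, [/\ p \in all_p, q \in all_p & P p q <= failure_bound R m].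
  apply: contrapT => none.
  have cnt : \sum_(p <- all_p) 1 = tot by exact: all_walks_count.
  have : \sum_(p <- all_p) \sum_(q <- all_p) failure_bound R m <
      \sum_(p <- all_p) \sum_(q <- all_p) P p q.
    have gt p q : p \in all_p -> q \in all_p -> failure_bound R m < P p q.
      by move=> pw qw; rewrite ltNge; apply/negP => le; apply: none; exists p, q.
    have ne : has xpredT all_p.
      rewrite has_predT; case: all_p cnt => // ; rewrite big_nil => t0.
      by have := tot_gt0; rewrite -t0 ltxx.
    rewrite big_seq [ltRHS]big_seq.
    have ne' : has (mem all_p) all_p by rewrite (eq_in_has (a2 := xpredT)).
    apply: ltr_sum => // p pw; rewrite big_seq [ltRHS]big_seq.
    by apply: ltr_sum => // q qw; exact: gt.
  apply/negP; rewrite -leNgt; apply: (le_trans avg).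
  rewrite le_eqVlt; apply/orP; left; apply/eqP.
  rewrite -[failure_bound R m]mul1r -mulr_suml cnt -[X in \sum_(_ <- _) X]mul1r -mulr_suml cnt.
  by ring.
(* One tour that is not bad is needed to certify that the set is large. *)
have [sigma good] : exists sigma, ~~ bad sigma p q.
  apply/existsP; apply: contraLR fb1 => /existsPn all_bad; rewrite -leNgt.
  apply: le_trans Ppq; rewrite -D1 /P /Prob [leRHS]big_mkcond; apply: ler_sum => sigma _.
  by move: (all_bad sigma); rewrite negbK => ->.
exists (walk_set p q); split.
- by move: good; rewrite negbK => /and3P[sp _ _]; exact: card_walk_set_ge sp.
- exact: card_walk_set_le.
apply: le_trans Ppq; rewrite /P /Prob big_mkcond [leRHS]big_mkcond; apply: ler_sum => s _.
case: ifPn => [cheap|_]; last by case: ifP.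
case: ifPn => // ; rewrite negbK => /and3P[sp sq pq].
have := spread_tour_cost_ge r sp sq pq.
have opt0 := opt_TSP_ge0 c_metric r (walk_set p q).
have optm := opt_walk_set_le r pw qw.
have m1 : 1 <= m%:R :> R by rewrite ler1n.
(* A cheap tour would cost at most [1030 / 50000 * m ^ 2], which is below [m ^ 2 / 40]. *)
have := ler_wpM2r opt0 t_small.
have : m%:R / (50 * 1000) * opt_TSP c r (walk_set p q) <= m%:R / (50 * 1000) * (1030 * m%:R).
  by apply: ler_wpM2l optm; lra.
have : 1 <= m%:R ^+ 2 :> R by rewrite exprn_ege1.
move: cheap; set a := tour_cost _ _ _; set b := t * _; set d := _ * opt_TSP _ _ _.
rewrite (_ : m%:R / (50 * 1000) * (1030 * m%:R) = m%:R ^+ 2 * (1030 / (50 * 1000))); last by ring.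
lra.
Qed.

End Instance.

(** * Instances of every size and the choice of constants *)

Lemma cube_embedding m n : (2 ^ m <= n.+1)%N ->
  exists (e : cube m -> 'I_n.+1) (f : 'I_n.+1 -> cube m), cancel e f.
Proof.
(* The default of [nth] sends all surplus vertices to 0; [code_dist] still separates them. *)
move=> mn; exists (fun g => inord (enum_rank g)), (fun v => nth 0 (enum {: cube m}) v) => g.
have lt_n : (enum_rank g < n.+1)%N.
  by apply: leq_trans mn; rewrite -card_cube; exact: ltn_ord.
by rewrite inordK // nth_enum_rank.
Qed.

Lemma leq_mul6_exp2 m : (5 <= m)%N -> (6 * m <= 2 ^ m)%N.
Proof.
elim: m => // m IH; rewrite leq_eqVlt => /orP[/eqP <- //|m_ge5].
by have := IH m_ge5; rewrite expnS; lia.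
Qed.

Lemma hard_instance (R : realType) m n : (2 ^ m <= n.+1)%N ->
  exists (c : 'I_n.+1 -> 'I_n.+1 -> R) (r : 'I_n.+1), is_metric c /\
    (10 ^+ 10 <= m%:R :> R -> forall (D : {ffun {perm 'I_n.+1} -> R}) (t : R),
      is_distribution D -> t <= m%:R / (50 * 1000) ->
      exists X : {set 'I_n.+1}, [/\ (3 * m <= 4 * #|X|)%N, (#|X| <= 514 * m)%N &
        Prob D (fun sigma => tour_cost c r (visit_order sigma X) <= t * opt_TSP c r X)
          <= 2^-1 * (9 / 10) ^+ m]).
Proof.
move=> mn; have [e [f eK]] := cube_embedding mn.
have [m0|m_gt0] := posnP m.
  (* A metric is required for every [n]; for [m = 0] an empty family of generators provides it and
     the rest is vacuous. *)
  pose h0 (j : 'I_0) : cube m := 0.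
  exists (code_dist h0 R f), ord0; split; first exact: code_dist_metric.
  by have -> : m%:R = 0 :> R; [rewrite m0|lra].
have [h h_code] := exists_code R m_gt0.
exists (code_dist h R f), ord0; split; first exact: code_dist_metric.
move=> m_big D t distD t_small.
have fb := failure_bound_le m_big.
have fb1 : failure_bound R m < 1.
  have : (9 / 10) ^+ m <= 1 :> R by apply: exprn_ile1; lra.
  lra.
have m_small : (6 * m <= 2 ^ m)%N.
  by apply: leq_mul6_exp2; rewrite -(ler_nat R); lra.
have [X [X_ge X_le PX]] := hard_set m_gt0 m_small eK h_code ord0 distD t_small fb1.
by exists X; split=> //; exact: le_trans PX fb.
Qed.

(* V_n = 'I_n.+1, so |V_n| = n.+1; all asymptotics are in |V| = n.+1. *)
Theorem theorem9 (R : realType) :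
  exists (c : forall n : nat, 'I_n.+1 -> 'I_n.+1 -> R)
         (r : forall n : nat, 'I_n.+1)
         (eps0 a b : R),
    [/\ 0 < eps0, 0 < a, a <= b,
        (forall n : nat, is_metric (c n)) &
        forall g : nat -> R, little_o_log g ->
          exists N : nat, forall n : nat, (N <= n)%N ->
            forall D : {ffun {perm 'I_n.+1} -> R}, is_distribution D ->
              exists X : {set 'I_n.+1},
                a * ln (n.+1)%:R <= #|X|%:R <= b * ln (n.+1)%:R /\
                Prob D (fun sigma =>
                   tour_cost (c n) (r n) (visit_order sigma X)
                     <= g n.+1 * opt_TSP (c n) (r n) X)
                  <= 2^-1 * expR (- (eps0 * #|X|%:R))].
Proof.
pose m n := trunc_log 2 n.+1.
have H n := cid (hard_instance R (@trunc_logP 2 n.+1 isT isT)).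
pose c n := sval (H n); have H' n := cid (svalP (H n)).
pose r n := sval (H' n).
have ln2_gt0 : 0 < ln (2%:R : R) by apply: ln_gt0; rewrite ltr1n.
have ln2_le1 : ln (2%:R : R) <= 1.
  by have := @le_ln1Dx R 1; rewrite -[2%:R]/(1 + 1 : R); apply; lra.
(* From [3 / 4 * m <= #|X| <= 514 * m] and [m * ln 2 <= ln n.+1 <= 2 * m]; [eps0] makes
   [eps0 * #|X|] at most [m / 10]. *)
exists c, r, (1 / (10 * 514)), (1 / 4), (514 / ln 2%:R); split; try lra.
- apply: (@le_trans _ _ 514); first by lra.
  by rewrite ler_pdivlMr // ler_piMr.
- by move=> n; case: (svalP (H' n)).
move=> g /(_ (1 / (100 * 1000))) [|M gM]; first by lra.
(* The power of 2 forces [m n] above [10 ^ 10]. *)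
exists (maxn M (2 ^ Num.bound (10 ^+ 10 : R))) => n; rewrite geq_max => /andP[Mn big_n] D distD.
have m_big : 10 ^+ 10 <= (m n)%:R :> R.
  apply: le_trans (ltW (archi_boundP _)) _; first by rewrite exprn_ge0.
  by rewrite ler_nat; apply: trunc_log_max => //; exact: leq_trans big_n _.
have n_pos : (n.+1)%:R \is @Num.pos R by rewrite posrE ltr0n.
have two_pos j : 2%:R ^+ j \is @Num.pos R by rewrite posrE exprn_gt0.
have ln_ge : (m n)%:R * ln 2%:R <= ln (n.+1)%:R :> R.
  rewrite mulr_natl -lnXn // ler_ln // -natrX ler_nat; exact: trunc_logP.
have ln_le : ln (n.+1)%:R <= 2 * (m n)%:R :> R.
  apply: (@le_trans _ _ ((m n).+1%:R * ln 2%:R)).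
    by rewrite mulr_natl -lnXn // ler_ln // -natrX ler_nat ltnW // trunc_log_ltn.
  apply: (@le_trans _ _ (m n).+1%:R); first by rewrite ler_piMr.
  by rewrite -natr1; lra.
have t_small : g n.+1 <= (m n)%:R / (50 * 1000).
  by apply: le_trans (ler_norm _) _; apply: le_trans (gM n.+1 (leqW Mn)) _; lra.
have [_ /(_ m_big D _ distD t_small)[X [X_ge X_le PX]]] := svalP (H' n).
have XgeR : 3 * (m n)%:R <= 4 * #|X|%:R :> R by rewrite -!natrM ler_nat.
have XleR : #|X|%:R <= 514 * (m n)%:R :> R by rewrite -natrM ler_nat.
exists X; split.
  apply/andP; split; first by lra.
  by rewrite mulrAC ler_pdivlMr //; have := ler_wpM2r (ltW ln2_gt0) XleR; lra.
apply: le_trans PX _; apply: ler_wpM2l; first by lra.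
(* Here [9 / 10 <= expR (- (1 / 10))], from [1 + x <= expR x]. *)
apply: (@le_trans _ _ (expR ((m n)%:R * - (1 / 10)))).
  rewrite expRM_natl; apply: lerXn2r; rewrite ?nnegrE ?expR_ge0 //; first by lra.
  by apply: le_trans (expR_ge1Dx _); lra.
by rewrite ler_expR; lra.
Qed.
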